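(* (Place-locality, TX10) If $\langle s,g\rangle$ is a place-local configuration and $\langle s,g\rangle\xrightarrow{\lambda}_p\langle s',g'\rangle$ (respectively $\langle s,g\rangle\xrightarrow{\lambda}_p g'$) in TX10, then $\langle s',g'\rangle$ is a place-local configuration (respectively $g'$ is a place-local heap).
   Context: **Syntax.** $\mathsf{Pl}=\{0,\dots,n-1\}$ is a finite set of places (ranged over by $p,q$). $\mathsf{ObjId}$ is an infinite set of object ids with a fixed bijection with $\mathbb N$ (the enumeration order); $\mathsf p:\mathsf{ObjId}\to\mathsf{Pl}$ gives the home place; $\mathsf{ObjId}_q=\{o:\mathsf p(o)=q\}$; global references are $\mathsf{grObjId}=\{o\$p : o\in\mathsf{ObjId}_p,\ p\in\mathsf{Pl}\}$. Values $v$: object ids $o$, global references $o\$p$, exception constants $\mathsf E,\mathsf{BF},\mathsf{BG},\mathsf{DP}$. Expressions: $e::= v\mid x\mid e.f\mid\{f_1{:}e_1,\dots,f_n{:}e_n\}\mid \mathtt{globalref}\ e\mid\mathtt{valof}\ e$. Statements: $s,t::=\mathtt{skip}\mid\mathtt{throw}\ v$ ($v$ an exception value) $\mid \mathtt{val}\ x=e\ s\mid e.f=e'\mid\{s\ t\}\mid\mathtt{at}(p)(\mathtt{val}\ x=e)\,s\mid\mathtt{async}\ s\mid\mathtt{finish}\ s\mid\mathtt{try}\ s\ \mathtt{catch}\ t$, plus the dynamic (runtime only) statements $\overline{\mathtt{at}}(p)\,s\mid\overline{\mathtt{async}}\,s\mid\mathtt{finish}_\mu\,s$ with $\mu$ a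 possibly empty set of (exception) values; $\mathtt{finish}\ s$ abbreviates $\mathtt{finish}_\emptyset\,s$. In $\mathtt{val}\ x=e\ s$ and $\mathtt{at}(p)(\mathtt{val}\ x=e)s$ the only free variable of $s$ is $x$. **Heaps and place-locality.** A local heap $h$ is a partial map from object ids to objects, an object being a partial map from field names to values. In TX10 (no place failure) a global heap $g$ maps every place of $\mathsf{Pl}$ to a local heap. $f[a\mapsto b]$ denotes map update. For $o\in\mathrm{dom}(h)$, $h_o$ is the set of all object values (object ids or global references) reachable from $o$ in $h$ via fields. A global heap $g$ is place-local if for every $q\in\mathrm{dom}(g)$, with $h=g(q)$: $\mathrm{dom}(h)\subseteq\mathsf{ObjId}_q$ and $h_o\subseteq(\mathsf{ObjId}_q\cap\mathrm{dom}(h))\cup\mathsf{grObjId}$ for all $o\in\mathrm{dom}(h)$. Given a place-local heap $g$, a configuration $\langle s,g\rangle$ is place-local if (a) for any local object id $o$ occurring in $s$ under $\mathtt{at}(p)$ or $\overline{\mathtt{at}}(p)$, $o\in\mathrm{dom}(g(p))$ (hence $o\in\mathsf{ObjId}_p$ by place-locality of $g$), and (b) for any global reference $o\$q$ occurring in $s$, $o\in\mathrm{dom}(g(q))$. **Predicates.** $\mathsf{isAsync}(\overline{\mathtt{async}}\,s)$; $\mathsf{isAsync}(s)$ implies $\mathsf{isAsync}(\overline{\mathtt{at}}(p)s)$ and $\mathsf{isAsync}(\mathtt{try}\,s\,\mathtt{catch}\,t)$; $\mathsf{isAsync}(s)$ and $\mathsf{isAsync}(t)$ imply $\mathsf{isAsync}(\{s\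 t\})$. **Transitions.** Configurations are $\langle s,g\rangle$ or $g$ (terminated). Labels $\lambda$: $\epsilon$ (normal), $v\otimes$ (synchronous exception), $v\times$ (asynchronous exception). $k\xrightarrow{\lambda}_p k'$ means that $k$ executing at place $p$ can in one step evolve to $k'$; $\to_p$ means $\xrightarrow{\epsilon}_p$. In rules, ''$A\mid B$'' in premise and conclusion denotes two rules, matching first with first and second with second. *Expressions* (at place $p$, local heap $h$): $\langle\{f_1{:}v_1,\dots,f_n{:}v_n\},h\rangle\to_p\langle o,h[o\mapsto\{f_i\mapsto v_i\}]\rangle$ with $o\in\mathsf{ObjId}_p\setminus\mathrm{dom}(h)$; $\langle o.f,h\rangle\to_p\langle v,h\rangle$ if $h(o)(f)=v$; $\langle o.f,h\rangle\xrightarrow{\mathsf{BF}\otimes}_p h$ if $f\notin\mathrm{dom}(h(o))$; $\langle\mathtt{globalref}\ o,h\rangle\to_p\langle o\$p,h\rangle$; $\langle\mathtt{valof}\ o\$p,h\rangle\to_p\langle o,h\rangle$; $\langle\mathtt{valof}\ v,h\rangle\xrightarrow{\mathsf{BG}\otimes}_p h$ if $v$ is not of the form $o\$p$; and if $\langle e,h\rangle\xrightarrow{\lambda}_p\langle e',h'\rangle\mid h$ then the same label is taken in the contexts $[\,].f$, $\mathtt{globalref}\,[\,]$, $\mathtt{valof}\,[\,]$, $\{f_1{:}v_1,\dots,f_i{:}v_i,f_{i+1}{:}[\,],\dots\}$ (leading to $h$ in the exceptional case). *Basic statements* (all require $p\in\mathrm{dom}(g)$): $\langle\mathtt{skip},g\rangle\to_p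 g$; $\langle\mathtt{throw}\ v,g\rangle\xrightarrow{v\otimes}_p g$; if $\langle s[v/x],g\rangle\xrightarrow{\lambda}_p\langle s',g'\rangle\mid g'$ then $\langle\mathtt{val}\ x=v\ s,g\rangle\xrightarrow{\lambda}_p\langle s',g'\rangle\mid g'$; $\langle o.f=v,g\rangle\to_p g[p\mapsto g(p)[o\mapsto g(p)(o)[f\mapsto v]]]$ if $f\in\mathrm{dom}(g(p)(o))$; $\langle o.f=v,g\rangle\xrightarrow{\mathsf{BF}\otimes}_p g$ if $f\notin\mathrm{dom}(g(p)(o))$; (Ctx) if $\langle e,g(p)\rangle\xrightarrow{\lambda}_p\langle e',h'\rangle\mid h'$ and $g'=g[p\mapsto h']$ then $\mathtt{val}\ x=e\ s$, $e.f=e_1$, $o.f=e$, $\mathtt{at}(q)(\mathtt{val}\ x=e)s$ in heap $g$ make a $\lambda$-step at $p$ to the same statement with $e'$ for $e$ in heap $g'$, resp. to $g'$. *Copy.* For $o\in\mathsf{ObjId}$ with $\mathsf p(o)\in\mathrm{dom}(g)$ and $q\in\mathrm{dom}(g)$, $\mathsf{copy}(o,q,g)=(o',g[q\mapsto h'])$ where $h'$ extends $h=g(q)$ by a fresh isomorphic copy, rooted at $o'$, of the object graph reachable from $o$ in $g(\mathsf p(o))$; the new ids are the next elements of $\mathsf{ObjId}_q$ and global references are preserved unchanged. For other values $\mathsf{copy}(v,q,g)=(v,g)$. *Remaining TX10 rules:* (Spawn) $\langle\mathtt{async}\ s,g\rangle\to_p\langle\overline{\mathtt{async}}\,s,g\rangle$.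 (Async) if $\langle s,g\rangle\xrightarrow{\lambda}_p\langle s',g'\rangle\mid g'$ then $\langle\overline{\mathtt{async}}\,s,g\rangle\xrightarrow{\lambda'}_p\langle\overline{\mathtt{async}}\,s',g'\rangle\mid g'$, with $\lambda'=\epsilon$ if $\lambda=\epsilon$ and $\lambda'=v\times$ if $\lambda\in\{v\times,v\otimes\}$. (Finish) if $\langle s,g\rangle\xrightarrow{\lambda}_p\langle s',g'\rangle$ then $\langle\mathtt{finish}_\mu s,g\rangle\to_p\langle\mathtt{finish}_{\mu\cup\lambda}s',g'\rangle$, where $\mu\cup\epsilon=\mu$ and $\mu\cup v\times=\mu\cup v\otimes=\mu\cup\{v\}$. (End of Finish) if $\langle s,g\rangle\xrightarrow{\lambda}_p g'$ then $\langle\mathtt{finish}_\mu s,g\rangle\xrightarrow{\lambda'}_p g'$ with $\lambda'=\epsilon$ if $\mu\cup\lambda=\emptyset$, else $\lambda'=\mathsf E\otimes$. (Seq) if $\langle s,g\rangle\xrightarrow{\lambda}_p\langle s',g'\rangle\mid g'$: if $\lambda\in\{\epsilon,v\times\}$, $\langle\{s\ t\},g\rangle\xrightarrow{\lambda}_p\langle\{s'\ t\},g'\rangle\mid\langle t,g'\rangle$; if $\lambda=v\otimes$, $\langle\{s\ t\},g\rangle\xrightarrow{\lambda}_p\langle s',g'\rangle\mid g'$. (Par) if $\mathsf{isAsync}(t)$ and $\langle s,g\rangle\xrightarrow{\lambda}_p\langle s',g'\rangle\mid g'$ then $\langle\{t\ s\},g\rangle\xrightarrow{\lambda}_p\langle\{t\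 s'\},g'\rangle\mid\langle t,g'\rangle$. (Place Shift) if $(v',g')=\mathsf{copy}(v,q,g)$ then $\langle\mathtt{at}(q)(\mathtt{val}\ x=v)s,g\rangle\to_p\langle\overline{\mathtt{at}}(q)\{s[v'/x]\ \mathtt{skip}\},g'\rangle$. (At) if $\langle s,g\rangle\xrightarrow{\lambda}_q\langle s',g'\rangle\mid g'$ then $\langle\overline{\mathtt{at}}(q)s,g\rangle\xrightarrow{\lambda}_p\langle\overline{\mathtt{at}}(q)s',g'\rangle\mid g'$. (Try) if $\langle s,g\rangle\xrightarrow{\lambda}_p\langle s',g'\rangle\mid g'$: if $\lambda\in\{\epsilon,v\times\}$, $\langle\mathtt{try}\,s\,\mathtt{catch}\,t,g\rangle\xrightarrow{\lambda}_p\langle\mathtt{try}\,s'\,\mathtt{catch}\,t,g'\rangle\mid g'$; if $\lambda=v\otimes$, $\langle\mathtt{try}\,s\,\mathtt{catch}\,t,g\rangle\to_p\langle\{s'\ t\},g'\rangle\mid\langle t,g'\rangle$.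
   Formalization: False as stated; mended, with all mends also proved preserved: object ids of s outside every at must lie in dom(g(p)) for the executing place p, g stores no dangling global references, and bodies of dynamic at are closed. *)

(* Defs.v *)
From HB Require Import structures.
From mathcomp Require Import all_boot.

Set Implicit Arguments.
Unset Strict Implicit.
Unset Printing Implicit Defensive.

(* Places are 'I_n.  Object ids are identified with nat along the fixed
   enumeration, so that the enumeration order is the order of nat; the home
   place is a function home : objid -> 'I_n, an explicit parameter below. *)
Definition objid := nat.
Definition field := nat.
Definition var := nat.

Inductive exn := ExnE | ExnBF | ExnBG | ExnDP.

Definition exn_code (x : exn) : bool * bool :=
  match x with
  | ExnE => (false, false) | ExnBF => (false, true)
  | ExnBG => (true, false) | ExnDP => (true, true)
  end.

Definition exn_decode (c : bool * bool) : exn :=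
  match c with
  | (false, false) => ExnE | (false, true) => ExnBF
  | (true, false) => ExnBG | (true, true) => ExnDP
  end.

Lemma exn_codeK : cancel exn_code exn_decode.
Proof. by case. Qed.

HB.instance Definition _ := Finite.copy exn (can_type exn_codeK).

(* VGlob o q is the global reference o$q.  Whether q is the home place of o is
   not built into the type: see gr_objid. *)
Inductive value (n : nat) :=
  | VLoc of objid
  | VGlob of objid & 'I_n
  | VExn of exn.
Arguments VLoc {n}.
Arguments VExn {n}.

Inductive expr (n : nat) :=
  | EVal of value n
  | EVar of var
  | EGet of expr n & field
  | ERec of seq (field * expr n)
  | EGlobalref of expr n
  | EValof of expr n.
Arguments EVar {n}.

(* SFinish mu s is finish_mu s; the source statement finish s is
   SFinish set0 s.  SDAt and SDAsync are the dynamic forms of at and async. *)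
Inductive stmt (n : nat) :=
  | SSkip
  | SThrow of exn
  | SVal of var & expr n & stmt n
  | SAssign of expr n & field & expr n
  | SSeq of stmt n & stmt n
  | SAt of 'I_n & var & expr n & stmt n
  | SAsync of stmt n
  | SFinish of {set exn} & stmt n
  | STry of stmt n & stmt n
  | SDAt of 'I_n & stmt n
  | SDAsync of stmt n.
Arguments SSkip {n}.
Arguments SThrow {n}.

Fixpoint expr_free n (x : var) (e : expr n) : bool :=
  match e with
  | EVal _ => false
  | EVar y => x == y
  | EGet e _ | EGlobalref e | EValof e => expr_free x e
  | ERec fs => has (fun fe => expr_free x fe.2) fs
  end.

Fixpoint stmt_free n (x : var) (s : stmt n) : bool :=
  match s with
  | SSkip | SThrow _ => false
  | SVal y e s | SAt _ y e s => expr_free x e || (x != y) && stmt_free x s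
  | SAssign e _ e' => expr_free x e || expr_free x e'
  | SSeq s t | STry s t => stmt_free x s || stmt_free x t
  | SAsync s | SFinish _ s | SDAt _ s | SDAsync s => stmt_free x s
  end.

(* The free-variable convention of the syntax.  A dynamic at only arises at run
   time, by executing a closed at statement, hence its body is closed. *)
Fixpoint wf_stmt n (s : stmt n) : Prop :=
  match s with
  | SSkip | SThrow _ | SAssign _ _ _ => True
  | SVal x _ s | SAt _ x _ s =>
      (forall y, stmt_free y s -> y = x) /\ wf_stmt s
  | SSeq s t | STry s t => wf_stmt s /\ wf_stmt t
  | SAsync s | SFinish _ s | SDAsync s => wf_stmt s
  | SDAt _ s => (forall y, ~~ stmt_free y s) /\ wf_stmt s
  end.

(* Substituted values are closed, so no renaming of binders is needed. *)
Fixpoint expr_subst n (x : var) (v : value n) (e : expr n) : expr n :=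
  match e with
  | EVal w => EVal w
  | EVar y => if y == x then EVal v else EVar y
  | EGet e f => EGet (expr_subst x v e) f
  | ERec fs => ERec (map (fun fe => (fe.1, expr_subst x v fe.2)) fs)
  | EGlobalref e => EGlobalref (expr_subst x v e)
  | EValof e => EValof (expr_subst x v e)
  end.

Fixpoint stmt_subst n (x : var) (v : value n) (s : stmt n) : stmt n :=
  match s with
  | SSkip => SSkip
  | SThrow k => SThrow k
  | SVal y e s =>
      SVal y (expr_subst x v e) (if y == x then s else stmt_subst x v s)
  | SAssign e f e' => SAssign (expr_subst x v e) f (expr_subst x v e')
  | SSeq s t => SSeq (stmt_subst x v s) (stmt_subst x v t)
  | SAt q y e s =>
      SAt q y (expr_subst x v e) (if y == x then s else stmt_subst x v s)
  | SAsync s => SAsync (stmt_subst x v s)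
  | SFinish mu s => SFinish mu (stmt_subst x v s)
  | STry s t => STry (stmt_subst x v s) (stmt_subst x v t)
  | SDAt q s => SDAt q (stmt_subst x v s)
  | SDAsync s => SDAsync (stmt_subst x v s)
  end.

Definition pmap_upd (A : eqType) (B : Type) (h : A -> B) (a : A) (b : B) :
  A -> B := fun a' => if a' == a then b else h a'.

Definition obj n := field -> option (value n).
Definition lheap n := objid -> option (obj n).

(* Without place failure the domain of a global heap is the set of all places,
   so the premises p \in dom(g) of the rules always hold. *)
Definition gheap n := 'I_n -> lheap n.

Definition in_dom n (h : lheap n) (o : objid) : Prop := h o <> None.

Definition gr_objid n (home : objid -> 'I_n) (v : value n) : Prop :=
  exists o, v = VGlob o (home o).

Definition is_objval n (v : value n) : bool :=
  if v is VExn _ then false else true.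

(* reach h o v: v belongs to h_o.  Global references are not followed. *)
Inductive reach n (h : lheap n) (o : objid) : value n -> Prop :=
  | reach_root : reach h o (VLoc o)
  | reach_field u ob f v :
      reach h o (VLoc u) -> h u = Some ob -> ob f = Some v -> is_objval v ->
      reach h o v.

Definition place_local_heap n (home : objid -> 'I_n) (g : gheap n) : Prop :=
  forall q,
    (forall o, in_dom (g q) o -> home o = q) /\
    (forall o, in_dom (g q) o -> forall v, reach (g q) o v ->
       (exists u, v = VLoc u /\ home u = q /\ in_dom (g q) u) \/
       gr_objid home v).

Fixpoint expr_occurs n (v : value n) (e : expr n) : Prop :=
  match e with
  | EVal w => w = v
  | EVar _ => False
  | EGet e _ | EGlobalref e | EValof e => expr_occurs v e
  | ERec fs => foldr (fun fe P => expr_occurs v fe.2 \/ P) False fs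
  end.

(* v occurs in s under at(q), q being the place of the innermost enclosing at
   or dynamic at; c stands for the place at which s itself is executed. *)
Fixpoint occurs_under n (c : 'I_n) (s : stmt n) (v : value n) (q : 'I_n) :
  Prop :=
  match s with
  | SSkip | SThrow _ => False
  | SVal _ e s => c = q /\ expr_occurs v e \/ occurs_under c s v q
  | SAssign e _ e' => c = q /\ (expr_occurs v e \/ expr_occurs v e')
  | SSeq s t | STry s t => occurs_under c s v q \/ occurs_under c t v q
  | SAt r _ e s => c = q /\ expr_occurs v e \/ occurs_under r s v q
  | SAsync s | SFinish _ s | SDAsync s => occurs_under c s v q
  | SDAt r s => occurs_under r s v q
  end.

(* Place-locality of <s, g> executed at p: an id outside every at counts as
   occurring under at(p).  Left unconstrained, o.f = o' could store the id of
   an object of another place into the heap of p. *)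
Definition place_local_config n (home : objid -> 'I_n) (p : 'I_n)
    (s : stmt n) (g : gheap n) : Prop :=
  [/\ place_local_heap home g,
      forall o q, occurs_under p s (VLoc o) q -> in_dom (g q) o
    & forall o q r, occurs_under p s (VGlob o q) r -> in_dom (g q) o].

(* No global reference stored in g is dangling.  place_local_heap allows
   dangling ones, and reading a field holding one would bring it into the
   statement, where place_local_config forbids it. *)
Definition grefs_defined n (g : gheap n) : Prop :=
  forall r u ob f o q, g r u = Some ob -> ob f = Some (VGlob o q) ->
    in_dom (g q) o.

Inductive label := Eps | Sync of exn | Async of exn.

Definition label_async (l : label) : label :=
  match l with Eps => Eps | Sync v | Async v => Async v end.

Definition label_add (mu : {set exn}) (l : label) : {set exn} :=
  match l with Eps => mu | Sync v | Async v => v |: mu end.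

Definition is_sync (l : label) : bool := if l is Sync _ then true else false.

Fixpoint is_async n (s : stmt n) : bool :=
  match s with
  | SDAsync _ => true
  | SDAt _ s | STry s _ => is_async s
  | SSeq s t => is_async s && is_async t
  | _ => false
  end.

Inductive econf (n : nat) := ERun of expr n & lheap n | EDone of lheap n.

Inductive conf (n : nat) := Run of stmt n & gheap n | Done of gheap n.

(* A pair of rules "A | B" is rendered by a single rule whose result is
   transformed by one of the following maps. *)
Definition econf_map n (C : expr n -> expr n) (k : econf n) : econf n :=
  match k with ERun e h => ERun (C e) h | EDone h => EDone h end.

Definition econf_lift n (C : expr n -> stmt n) (g : gheap n) (p : 'I_n)
    (k : econf n) : conf n :=
  match k with
  | ERun e h => Run (C e) (pmap_upd g p h)
  | EDone h => Done (pmap_upd g p h)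
  end.

Definition conf_map n (C : stmt n -> stmt n) (k : conf n) : conf n :=
  match k with Run s g => Run (C s) g | Done g => Done g end.

Definition conf_map_else n (C : stmt n -> stmt n) (t : stmt n) (k : conf n) :
  conf n := match k with Run s g => Run (C s) g | Done g => Run t g end.

Definition rec_obj n (fs : seq (field * value n)) : obj n :=
  fun f => ohead [seq fv.2 | fv <- fs & fv.1 == f].

Definition rec_vals n (fs : seq (field * value n)) : seq (field * expr n) :=
  [seq (fv.1, EVal fv.2) | fv <- fs].

Inductive estep n (home : objid -> 'I_n) (p : 'I_n) :
    expr n -> lheap n -> label -> econf n -> Prop :=
  | estep_new fs h o :
      home o = p -> h o = None ->
      estep home p (ERec (rec_vals fs)) h Eps
        (ERun (EVal (VLoc o)) (pmap_upd h o (Some (rec_obj fs))))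
  | estep_get o f h ob v :
      h o = Some ob -> ob f = Some v ->
      estep home p (EGet (EVal (VLoc o)) f) h Eps (ERun (EVal v) h)
  | estep_get_bad o f h ob :
      h o = Some ob -> ob f = None ->
      estep home p (EGet (EVal (VLoc o)) f) h (Sync ExnBF) (EDone h)
  | estep_globalref o h :
      estep home p (EGlobalref (EVal (VLoc o))) h Eps
        (ERun (EVal (VGlob o p)) h)
  | estep_valof o h :
      estep home p (EValof (EVal (VGlob o p))) h Eps (ERun (EVal (VLoc o)) h)
  | estep_valof_bad v h :
      (forall o, v <> VGlob o p) ->
      estep home p (EValof (EVal v)) h (Sync ExnBG) (EDone h)
  | estep_ctx_get e f h l k :
      estep home p e h l k ->
      estep home p (EGet e f) h l (econf_map (fun e' => EGet e' f) k)
  | estep_ctx_globalref e h l k :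
      estep home p e h l k ->
      estep home p (EGlobalref e) h l (econf_map (@EGlobalref n) k)
  | estep_ctx_valof e h l k :
      estep home p e h l k ->
      estep home p (EValof e) h l (econf_map (@EValof n) k)
  | estep_ctx_rec fs f e fs' h l k :
      estep home p e h l k ->
      estep home p (ERec (rec_vals fs ++ (f, e) :: fs')) h l
        (econf_map (fun e' => ERec (rec_vals fs ++ (f, e') :: fs')) k).

Definition rename_val n (iota : objid -> objid) (v : value n) : value n :=
  if v is VLoc u then VLoc (iota u) else v.

Definition rename_obj n (iota : objid -> objid) (ob : obj n) : obj n :=
  fun f => omap (rename_val iota) (ob f).

(* copy home v q g v' g' : copy(v, q, g) = (v', g').  The new ids iota u are
   the first ids of ObjId_q, in the enumeration order, that are not in use; the
   order in which the copied objects receive them is left open, which is why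
   copy is a relation. *)
Inductive copy n (home : objid -> 'I_n) :
    value n -> 'I_n -> gheap n -> value n -> gheap n -> Prop :=
  | copy_other v q g :
      (forall o, v <> VLoc o) -> copy home v q g v g
  | copy_obj o q g (iota : objid -> objid) (h' : lheap n) :
      let R u := reach (g (home o)) o (VLoc u) in
      (forall u w, R u -> R w -> iota u = iota w -> u = w) ->
      (forall u, R u -> home (iota u) = q /\ g q (iota u) = None) ->
      (forall u w, R u -> w < iota u -> home w = q -> g q w = None ->
         exists2 u', R u' & iota u' = w) ->
      (forall u, R u -> h' (iota u) = omap (rename_obj iota) (g (home o) u)) ->
      (forall w, (forall u, R u -> iota u <> w) -> h' w = g q w) ->
      copy home (VLoc o) q g (VLoc (iota o)) (pmap_upd g q h').

Inductive step n (home : objid -> 'I_n) :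
    'I_n -> label -> conf n -> conf n -> Prop :=
  | step_skip p g : step home p Eps (Run SSkip g) (Done g)
  | step_throw p v g : step home p (Sync v) (Run (SThrow v) g) (Done g)
  | step_val p x v s g l k :
      step home p l (Run (stmt_subst x v s) g) k ->
      step home p l (Run (SVal x (EVal v) s) g) k
  | step_assign p o f v g ob :
      g p o = Some ob -> ob f <> None ->
      step home p Eps (Run (SAssign (EVal (VLoc o)) f (EVal v)) g)
        (Done (pmap_upd g p
                 (pmap_upd (g p) o (Some (pmap_upd ob f (Some v))))))
  | step_assign_bad p o f v g ob :
      g p o = Some ob -> ob f = None ->
      step home p (Sync ExnBF) (Run (SAssign (EVal (VLoc o)) f (EVal v)) g)
        (Done g)
  | step_ctx_val p x e s g l k :
      estep home p e (g p) l k ->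
      step home p l (Run (SVal x e s) g)
        (econf_lift (fun e' => SVal x e' s) g p k)
  | step_ctx_assign_l p e f e1 g l k :
      estep home p e (g p) l k ->
      step home p l (Run (SAssign e f e1) g)
        (econf_lift (fun e' => SAssign e' f e1) g p k)
  | step_ctx_assign_r p o f e g l k :
      estep home p e (g p) l k ->
      step home p l (Run (SAssign (EVal (VLoc o)) f e) g)
        (econf_lift (fun e' => SAssign (EVal (VLoc o)) f e') g p k)
  | step_ctx_at p q x e s g l k :
      estep home p e (g p) l k ->
      step home p l (Run (SAt q x e s) g)
        (econf_lift (fun e' => SAt q x e' s) g p k)
  | step_spawn p s g : step home p Eps (Run (SAsync s) g) (Run (SDAsync s) g)
  | step_async p s g l k :
      step home p l (Run s g) k ->
      step home p (label_async l) (Run (SDAsync s) g) (conf_map (@SDAsync n) k)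
  | step_finish p mu s g l s' g' :
      step home p l (Run s g) (Run s' g') ->
      step home p Eps (Run (SFinish mu s) g)
        (Run (SFinish (label_add mu l) s') g')
  | step_finish_end p mu s g l g' :
      step home p l (Run s g) (Done g') ->
      step home p (if label_add mu l == set0 then Eps else Sync ExnE)
        (Run (SFinish mu s) g) (Done g')
  | step_seq p s t g l k :
      ~~ is_sync l -> step home p l (Run s g) k ->
      step home p l (Run (SSeq s t) g) (conf_map_else (fun s' => SSeq s' t) t k)
  | step_seq_sync p s t g v k :
      step home p (Sync v) (Run s g) k ->
      step home p (Sync v) (Run (SSeq s t) g) k
  | step_par p s t g l k :
      is_async t -> step home p l (Run s g) k ->
      step home p l (Run (SSeq t s) g) (conf_map_else (fun s' => SSeq t s') t k)
  | step_place_shift p q x v s g v' g' :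
      copy home v q g v' g' ->
      step home p Eps (Run (SAt q x (EVal v) s) g)
        (Run (SDAt q (SSeq (stmt_subst x v' s) SSkip)) g')
  | step_at p q s g l k :
      step home q l (Run s g) k ->
      step home p l (Run (SDAt q s) g) (conf_map (@SDAt n q) k)
  | step_try p s t g l k :
      ~~ is_sync l -> step home p l (Run s g) k ->
      step home p l (Run (STry s t) g) (conf_map (fun s' => STry s' t) k)
  | step_try_catch p s t g v k :
      step home p (Sync v) (Run s g) k ->
      step home p Eps (Run (STry s t) g)
        (conf_map_else (fun s' => SSeq s' t) t k).

(* Main.v *)
Require Import Defs.
From mathcomp Require Import all_boot.
From Stdlib Require Import Classical FunctionalExtensionality.

(** Place-locality of a heap amounts to an invariant on single objects: every
    field of an object at place q holds a value that is meaningful at q.  A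
    configuration is place-local when, moreover, every value occurring in its
    statement is meaningful at the place at which it would be evaluated.  Both
    parts are stable because domains of heaps only grow along transitions, and
    because the free-variable convention keeps a substitution from carrying a
    value into the body of an at: the only value crossing places is the one
    passed to copy. *)

(** * Induction, occurrences, free variables and substitution *)

(** The generated principle gives no hypothesis for expressions nested in the list of a record; here
    records are built up field by field. *)
Lemma expr_nested_ind {n} (P : expr n -> Prop) :
  (forall v, P (EVal v)) -> (forall x, P (EVar x)) ->
  (forall e f, P e -> P (EGet e f)) ->
  P (ERec [::]) ->
  (forall f e fs, P e -> P (ERec fs) -> P (ERec ((f, e) :: fs))) ->
  (forall e, P e -> P (EGlobalref e)) -> (forall e, P e -> P (EValof e)) ->
  forall e, P e.
Proof.
move=> Pval Pvar Pget Pnil Pcons Pgref Pvalof; fix IH 1 => -[].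
- exact: Pval.
- exact: Pvar.
- by move=> e f; apply: Pget; apply: IH.
- elim=> [|[f e] fs IHfs]; first exact: Pnil.
  by apply: Pcons; [apply: IH | apply: IHfs].
- by move=> e; apply: Pgref; apply: IH.
- by move=> e; apply: Pvalof; apply: IH.
Qed.

Lemma expr_occurs_cat {n} (v : value n) fs1 f e fs2 :
  expr_occurs v (ERec (fs1 ++ (f, e) :: fs2)) <->
  [\/ expr_occurs v (ERec fs1), expr_occurs v e | expr_occurs v (ERec fs2)].
Proof.
elim: fs1 => [|[f1 e1] fs1 /= [IH1 IH2]] /=.
  by split=> [[|]|[]] //; auto; [apply: Or32 | apply: Or33].
split=> [[|/IH1 []]|[[|]|/=|/=]]; auto.
- by move=> H; apply: Or31; left.
- by move=> H; apply: Or31; right.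
- exact: Or32.
- exact: Or33.
- by move=> H; right; apply: IH2; apply: Or31.
- by move=> H; right; apply: IH2; apply: Or32.
- by move=> H; right; apply: IH2; apply: Or33.
Qed.

Lemma rec_obj_occurs {n} (fs : seq (field * value n)) f v :
  rec_obj fs f = Some v -> expr_occurs v (ERec (rec_vals fs)).
Proof.
rewrite /rec_obj; elim: fs => [|[f1 v1] fs IH] //=.
by case: eqP => _ /= => [[->]|/IH]; [left | right].
Qed.

Lemma expr_free_subst {n} (x y : var) (v : value n) e :
  expr_free y (expr_subst x v e) = (y != x) && expr_free y e.
Proof.
elim/@expr_nested_ind: e => /= [w|z|e f ->|||e ->|e ->] //; rewrite ?andbF //.
- have [->|zx] := eqVneq z x; first by rewrite andNb.
  by rewrite /=; have [->|] := eqVneq y z; rewrite ?andbF ?zx.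
- by move=> f e fs -> -> /=; rewrite andb_orr.
Qed.

Lemma stmt_free_subst {n} (x y : var) (v : value n) s :
  stmt_free y (stmt_subst x v s) = (y != x) && stmt_free y s.
Proof.
elim: s => /= [||z e s IH|e f e'|s IHs t IHt|q z e s IH|||s IHs t IHt||] //;
  rewrite ?expr_free_subst ?andbF -?andb_orr ?IHs ?IHt -?andb_orr //.
all: rewrite !andb_orr; congr (_ || _).
(* If the binder [z] is [x], the body is untouched and the binder itself supplies the factor
   [y != x]. *)
all: have [->|zx] := eqVneq z x; first by rewrite andbA andbb.
all: by rewrite IH andbCA.
Qed.

Lemma expr_subst_notfree {n} (x : var) (v : value n) e :
  ~~ expr_free x e -> expr_subst x v e = e.
Proof.
elim/@expr_nested_ind: e => /= [w|y|e f IH|||e IH|e IH] //; last 2 first.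
- by move/IH->.
- by move/IH->.
- by rewrite eq_sym => /negbTE->.
- by move/IH->.
- by move=> f e fs IHe IHfs; rewrite negb_or => /andP[/IHe-> /IHfs[->]].
Qed.

Lemma stmt_subst_notfree {n} (x : var) (v : value n) s :
  ~~ stmt_free x s -> stmt_subst x v s = s.
Proof.
elim: s => /= [||y e s IH|e f e'|s IHs t IHt|q y e s IH|s IH|mu s IH
  |s IHs t IHt|q s IH|s IH] //; rewrite ?negb_or.
- case/andP=> /expr_subst_notfree->; rewrite eq_sym.
  by case: eqP => //= _ /IH->.
- by case/andP=> /expr_subst_notfree-> /expr_subst_notfree->.
- by case/andP=> /IHs-> /IHt->.
- case/andP=> /expr_subst_notfree->; rewrite eq_sym.
  by case: eqP => //= _ /IH->.
- by move/IH->.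
- by move/IH->.
- by case/andP=> /IHs-> /IHt->.
- by move/IH->.
- by move/IH->.
Qed.

(** Substituting a closed value only removes free variables, so every binder condition survives. *)
Lemma wf_stmt_subst {n} (x : var) (v : value n) s :
  wf_stmt s -> wf_stmt (stmt_subst x v s).
Proof.
elim: s => /= [||y e s IH|e f e'|s IHs t IHt|q y e s IH|s IH|mu s IH
  |s IHs t IHt|q s IH|s IH] //.
- case=> fs ws; case: ifP => // _; split; last exact: IH.
  by move=> z; rewrite stmt_free_subst => /andP[_ /fs].
- by case=> /IHs ? /IHt.
- case=> fs ws; case: ifP => // _; split; last exact: IH.
  by move=> z; rewrite stmt_free_subst => /andP[_ /fs].
- by case=> /IHs ? /IHt.
- case=> fs /IH ws; split=> // y.
  by rewrite stmt_free_subst negb_and (fs y) orbT.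
Qed.

Lemma expr_occurs_subst {n} (x : var) (v w : value n) e :
  expr_occurs w (expr_subst x v e) -> expr_occurs w e \/ w = v.
Proof.
elim/@expr_nested_ind: e => /= [u|y||||e IH|e IH] //; auto.
- by case: eqP => //= _ ->; right.
- by move=> f e fs IHe IHfs [/IHe|/IHfs] [] ; auto.
Qed.

(* Well-formedness is essential: the body of an at must not contain [x], or
   [v] would end up at a place other than [c]. *)
Lemma occurs_under_subst {n} (x : var) (v w : value n) (c q : 'I_n) s :
  wf_stmt s -> occurs_under c (stmt_subst x v s) w q ->
  occurs_under c s w q \/ c = q /\ w = v.
Proof.
elim: s c => /= [||y e s IH|e f e'|s IHs t IHt|r y e s IH|s IH|mu s IH
  |s IHs t IHt|r s IH|s IH] c //; auto.
- case=> fs ws [[-> /expr_occurs_subst []]|]; auto.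
  by case: ifP => _; [auto | case/(IH _ ws); auto].
- by move=> _ [-> [] /expr_occurs_subst []]; auto.
- by case=> ws wt [/(IHs _ ws)|/(IHt _ wt)] []; auto.
- case=> fs ws [[-> /expr_occurs_subst []]|]; auto.
  have [_|yx] := eqVneq y x; first by auto.
  rewrite stmt_subst_notfree; first by auto.
  by apply/negP => /fs xy; rewrite xy eqxx in yx.
- by case=> ws wt [/(IHs _ ws)|/(IHt _ wt)] []; auto.
- by case=> fs ws; rewrite stmt_subst_notfree //; left.
Qed.

(** * Place-locality as a condition on single values *)

(** A global reference is judged at the place it names, so only for local ids does the verdict
    depend on [q]. *)
Definition value_ok {n} (g : gheap n) (q : 'I_n) (v : value n) : Prop :=
  match v with
  | VLoc o => in_dom (g q) o
  | VGlob o r => in_dom (g r) o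
  | VExn _ => True
  end.

Definition heap_ok {n} (home : objid -> 'I_n) (g : gheap n) : Prop :=
  forall q u ob, g q u = Some ob ->
    home u = q /\ forall f v, ob f = Some v -> value_ok g q v.

Definition expr_ok {n} (g : gheap n) (p : 'I_n) (e : expr n) : Prop :=
  forall v, expr_occurs v e -> value_ok g p v.

Definition stmt_ok {n} (g : gheap n) (p : 'I_n) (s : stmt n) : Prop :=
  forall v q, occurs_under p s v q -> value_ok g q v.

Definition dom_le {n} (g g' : gheap n) : Prop :=
  forall q o, in_dom (g q) o -> in_dom (g' q) o.

Lemma in_domP {n} (h : lheap n) o : in_dom h o -> exists ob, h o = Some ob.
Proof. by rewrite /in_dom; case: (h o) => // ob _; exists ob. Qed.

(** Forwards, a reached value is either the root or stored in a field, where [heap_ok] judges it;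
    backwards, each field is a path of length one. *)
Lemma heap_okP {n} (home : objid -> 'I_n) (g : gheap n) :
  heap_ok home g <-> grefs_defined g /\ place_local_heap home g.
Proof.
split=> [ok|[gd pl] q u ob gu].
- have home_dom q o : in_dom (g q) o -> home o = q.
    by case/in_domP=> ob /ok [].
  split=> [r u ob f o q gu obf|q].
    by have [_ /(_ _ _ obf)] := ok _ _ _ gu.
  split=> [|o od v]; first exact: home_dom.
  elim=> [|u ob f {}v _ _ gu obf objv].
    by left; exists o; split=> //; split=> //; apply: home_dom.
  have [_ /(_ _ _ obf)] := ok _ _ _ gu.
  case: v objv {obf} => [w|w r|x] //= _ wd.
    by left; exists w; split=> //; split=> //; apply: home_dom.
  (* Being defined at [r] forces [r] to be the home of [w], so the reference is genuine. *)
  by rewrite -(home_dom _ _ wd); right; exists w.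
- have ud : in_dom (g q) u by rewrite /in_dom gu.
  have [pl1 pl2] := pl q; split=> [|f v obf]; first exact: pl1.
  case: v obf => [w|w r|x] //= obf; last exact: gd gu obf.
  have [|[w' [[->] []]]|[? []]] // := pl2 _ ud (VLoc w).
  exact: reach_field (reach_root _ _) gu obf _.
Qed.

Lemma place_local_configP {n} (home : objid -> 'I_n) p s (g : gheap n) :
  grefs_defined g /\ place_local_config home p s g <->
  heap_ok home g /\ stmt_ok g p s.
Proof.
split=> [[gd [pl ls gs]]|[/heap_okP[gd pl] ok]].
  split; first exact/heap_okP.
  by move=> [o|o r|x] q //=; [apply: ls | apply: gs].
by split=> //; split=> // o q => [|r]; apply: ok.
Qed.

Lemma value_ok_le {n} (g g' : gheap n) q v :
  dom_le g g' -> value_ok g q v -> value_ok g' q v.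
Proof. by move=> le; case: v => [o|o r|x] //=; apply: le. Qed.

Lemma stmt_ok_le {n} (g g' : gheap n) p s :
  dom_le g g' -> stmt_ok g p s -> stmt_ok g' p s.
Proof. by move=> le ok v q /ok; apply: value_ok_le. Qed.

Lemma pmap_upd_id {n} (g : gheap n) p : pmap_upd g p (g p) = g.
Proof.
by apply: functional_extensionality => q; rewrite /pmap_upd; case: eqP => [->|].
Qed.

Lemma dom_le_upd {n} (g : gheap n) p h :
  (forall o, in_dom (g p) o -> in_dom h o) -> dom_le g (pmap_upd g p h).
Proof. by move=> le q o; rewrite /pmap_upd; case: eqP => [->|//]; apply: le. Qed.

Lemma in_dom_upd {n} (h : lheap n) o ob u :
  in_dom h u -> in_dom (pmap_upd h o (Some ob)) u.
Proof. by rewrite /in_dom /pmap_upd; case: eqP. Qed.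

(** Serves both allocation, with [o] fresh, and field update, with [o] already present. Field values
    are judged in the old heap and carried over by domain growth. *)
Lemma heap_ok_upd {n} (home : objid -> 'I_n) (g : gheap n) p o ob :
  heap_ok home g -> home o = p ->
  (forall f v, ob f = Some v -> value_ok g p v) ->
  heap_ok home (pmap_upd g p (pmap_upd (g p) o (Some ob))).
Proof.
move=> ok ho obok.
have le : dom_le g (pmap_upd g p (pmap_upd (g p) o (Some ob))).
  by apply: dom_le_upd => u; apply: in_dom_upd.
move=> q u ob'; rewrite {1}/pmap_upd; case: eqP => [->|_]; last first.
  by case/ok=> hu okf; split=> // f v /okf; apply: value_ok_le.
rewrite {1}/pmap_upd; case: eqP => [-> [<-]|_].
  by split=> // f v /obok; apply: value_ok_le.
by case/ok=> hu okf; split=> // f v /okf; apply: value_ok_le.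
Qed.

(** * Invariants of configurations, and expression steps *)

Definition econf_heap {n} (k : econf n) : lheap n :=
  match k with ERun _ h | EDone h => h end.

Definition conf_heap {n} (k : conf n) : gheap n :=
  match k with Run _ g | Done g => g end.

Definition econf_free {n} (y : var) (k : econf n) : bool :=
  if k is ERun e _ then expr_free y e else false.

Definition conf_free {n} (y : var) (k : conf n) : bool :=
  if k is Run s _ then stmt_free y s else false.

(** The resulting local heap is put back into [g] because global references can only be judged in
    the full heap. *)
Definition econf_ok {n} (home : objid -> 'I_n) (g : gheap n) (p : 'I_n)
    (k : econf n) : Prop :=
  heap_ok home (pmap_upd g p (econf_heap k)) /\
  if k is ERun e h then expr_ok (pmap_upd g p h) p e else True.

Definition conf_ok {n} (home : objid -> 'I_n) (p : 'I_n) (k : conf n) : Prop :=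
  heap_ok home (conf_heap k) /\
  if k is Run s g then wf_stmt s /\ stmt_ok g p s else True.

Lemma estep_free {n} (home : objid -> 'I_n) p e h l k y :
  estep home p e h l k -> econf_free y k -> expr_free y e.
Proof.
elim=> //= {e h l k}.
- by move=> e f h l [e' h'|h'].
- by move=> e h l [e' h'|h'].
- by move=> e h l [e' h'|h'].
move=> fs f e fs' h l [e' h'|h'] //= _ IH.
by rewrite !has_cat /= => /or3P[->|/IH->|->]; rewrite ?orbT.
Qed.

Lemma estep_dom {n} (home : objid -> 'I_n) p e h l k o :
  estep home p e h l k -> in_dom h o -> in_dom (econf_heap k) o.
Proof.
elim=> //= {e h l k}.
- by move=> fs h u _ _; apply: in_dom_upd.
- by move=> e f h l [].
- by move=> e h l [].
- by move=> e h l [].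
- by move=> fs f e fs' h l [].
Qed.

(** A field read is safe because [heap_ok] vouches for stored values; [globalref] and [valof]
    exchange two values that rest on the same fact, that [o] is defined at [p]. *)
Lemma estep_ok {n} (home : objid -> 'I_n) (g : gheap n) p e h l k :
  estep home p e h l k -> h = g p -> heap_ok home g -> expr_ok g p e ->
  econf_ok home g p k.
Proof.
move=> st; elim: st => {e h l k}.
- move=> fs h o ho hn -> ok eok; split=> /=.
    by apply: heap_ok_upd => // f v /rec_obj_occurs /eok.
  by move=> v <- /=; rewrite /in_dom /pmap_upd !eqxx.
- move=> o f h ob v ho obf hg ok _.
  rewrite /econf_ok /= hg pmap_upd_id; split=> // w <-.
  by rewrite hg in ho; have [_ /(_ _ _ obf)] := ok _ _ _ ho.
- by move=> o f h ob _ _ -> ok _; rewrite /econf_ok /= pmap_upd_id.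
- move=> o h -> ok eok; rewrite /econf_ok /= pmap_upd_id; split=> // v <-.
  exact: (eok (VLoc o)).
- move=> o h -> ok eok; rewrite /econf_ok /= pmap_upd_id; split=> // v <-.
  exact: (eok (VGlob o p)).
- by move=> v h _ -> ok _; rewrite /econf_ok /= pmap_upd_id.
- by move=> e f h l [e' h'|h'] _ IH hg ok eok; apply: IH.
- by move=> e h l [e' h'|h'] _ IH hg ok eok; apply: IH.
- by move=> e h l [e' h'|h'] _ IH hg ok eok; apply: IH.
- move=> fs f e fs' h l k st IH hg ok eok.
  have [|hok] := IH hg ok.
    by move=> v ev; apply: eok; apply/expr_occurs_cat; apply: Or32.
  case: k st hok {IH} => [e' h'|h'] st //= hok e'ok; split=> //= v.
  (* The other fields of the record were judged before the step; domain growth carries them to the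
     new heap. *)
  have le : dom_le g (pmap_upd g p h').
    by apply: dom_le_upd => u; rewrite -hg; apply: estep_dom st.
  case/expr_occurs_cat => [vfs||vfs']; last 2 first.
  + exact: e'ok.
  + by apply: value_ok_le le _; apply: eok; apply/expr_occurs_cat; apply: Or33.
  + by apply: value_ok_le le _; apply: eok; apply/expr_occurs_cat; apply: Or31.
Qed.

(** * Copying an object graph to another place *)

Lemma copy_dom {n} (home : objid -> 'I_n) v q g v' g' :
  copy home v q g v' g' -> dom_le g g'.
Proof.
case=> [{}v {}q {}g _ r u|o {}q {}g iota h' R _ fresh _ _ hother] //.
(* Ids in the range of [iota] were undefined, so an already defined [w] lies outside it and keeps
   its entry. *)
apply: dom_le_upd => w wd; rewrite /in_dom hother // => u Ru iw.
by have [_ gn] := fresh u Ru; rewrite iw in gn; apply: wd.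
Qed.

(** Place-locality of the source puts all local ids reachable from [o] in the domain of one local
    heap, so their images are defined in [h']. Renamed fields thus point inside the copy, and global
    references stay defined because domains grow. *)
Lemma copy_ok {n} (home : objid -> 'I_n) p v q g v' g' :
  copy home v q g v' g' -> heap_ok home g -> value_ok g p v ->
  heap_ok home g' /\ value_ok g' q v'.
Proof.
move=> cp; have le := copy_dom _ _ _ _ _ _ cp.
case: cp le => [{}v {}q {}g vn le ok|].
  (* A global reference or an exception is judged alike at [p] and at [q]. *)
  by case: v vn => [o /(_ o)|o r|x].
move=> o {}q {}g iota h' R inj fresh _ himg hother le ok od.
(* [ho] identifies [p] with the home of [o], the place whose heap is copied. *)
have [ob go] := in_domP _ _ od; have [ho _] := ok _ _ _ go.
have Rdom u : R u -> in_dom (g (home o)) u.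
  have [_ /(_ (home o)) [_ pl]] := (heap_okP home g).1 ok.
  by rewrite -ho in od; case/(pl _ od) => [[w [[->] []]]|[w []]].
have iota_dom u : R u -> in_dom h' (iota u).
  by move=> Ru; rewrite /in_dom himg //; case/in_domP: (Rdom u Ru) => ? ->.
split; last first.
  by rewrite /= /pmap_upd eqxx; apply: iota_dom; apply: reach_root.
move=> r w ob'; rewrite {1}/pmap_upd; case: eqP => [->|_]; last first.
  by case/ok=> hw okf; split=> // f x /okf; apply: value_ok_le.
(* Reachability lives in [Prop], so whether [w] is a new id is split classically. *)
case: (classic (exists2 u, R u & iota u = w)) => [[u Ru <-]|nR]; last first.
  rewrite hother => [|u Ru uw]; last by apply: nR; exists u.
  by case/ok=> hw okf; split=> // f x /okf; apply: value_ok_le.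
rewrite himg //; case gu: (g (home o) u) => [obu|] //= [<-].
have [hu _] := fresh u Ru; split=> // f x; rewrite /rename_obj.
case obf: (obu f) => [y|] //= [<-].
have [_ /(_ _ _ obf)] := ok _ _ _ gu.
case: y obf => [z|z r'|y] //= obf zd; last exact: (le r').
(* [z] is reachable through [u], so its image was allocated too. *)
rewrite /pmap_upd eqxx; apply: iota_dom.
exact: reach_field Ru gu obf _.
Qed.

(** * Statement steps *)

(** No rule introduces free variables; this is what keeps the body of a dynamic [at] closed while it
    runs. *)
Lemma step_free {n} (home : objid -> 'I_n) p l k k' y :
  step home p l k k' -> conf_free y k' -> conf_free y k.
Proof.
elim=> //= {p l k k'}.
- by move=> p x v s g l k _ IH /IH; rewrite stmt_free_subst => /andP[-> ->].
- move=> p x e s g l [e' h'|h'] //= st /orP[ye|->]; rewrite ?orbT //.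
  by rewrite (estep_free _ _ _ _ _ _ _ st ye).
- move=> p e f e1 g l [e' h'|h'] //= st /orP[ye|->]; rewrite ?orbT //.
  by rewrite (estep_free _ _ _ _ _ _ _ st ye).
- move=> p o f e g l [e' h'|h'] //= st ye.
  by rewrite (estep_free _ _ _ _ _ _ _ st ye).
- move=> p q x e s g l [e' h'|h'] //= st /orP[ye|->]; rewrite ?orbT //.
  by rewrite (estep_free _ _ _ _ _ _ _ st ye).
- by move=> p s g l [].
- move=> p s t g l [s' g'|g'] _ _ /= IH; last by move=> ->; rewrite orbT.
  by case/orP => [/IH->|->]; rewrite ?orbT.
- by move=> p s t g v k _ IH /IH->.
- move=> p s t g l [s' g'|g'] _ _ /= IH; last by move=> ->.
  by case/orP => [->|/IH->]; rewrite ?orbT.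
- by move=> p q x v s g v' g' _; rewrite orbF stmt_free_subst.
- by move=> p q s g l [].
- move=> p s t g l [s' g'|g'] _ _ //= IH.
  by case/orP => [/IH->|->]; rewrite ?orbT.
- move=> p s t g v [s' g'|g'] _ /= IH; last by move=> ->; rewrite orbT.
  by case/orP => [/IH->|->]; rewrite ?orbT.
Qed.

Lemma conf_heap_map {n} (C : stmt n -> stmt n) k :
  conf_heap (conf_map C k) = conf_heap k.
Proof. by case: k. Qed.

Lemma conf_heap_map_else {n} (C : stmt n -> stmt n) t k :
  conf_heap (conf_map_else C t k) = conf_heap k.
Proof. by case: k. Qed.

Lemma conf_heap_lift {n} (C : expr n -> stmt n) g p k :
  conf_heap (econf_lift C g p k) = pmap_upd g p (econf_heap k).
Proof. by case: k. Qed.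

(** No rule deallocates. Statements that stay idle during a step therefore keep their validity. *)
Lemma step_dom {n} (home : objid -> 'I_n) p l k k' :
  step home p l k k' -> dom_le (conf_heap k) (conf_heap k').
Proof.
elim=> //= {p l k k'}; intros;
  rewrite ?conf_heap_map ?conf_heap_map_else ?conf_heap_lift //.
all: try by apply: dom_le_upd => u; apply: estep_dom; eassumption.
  by apply: dom_le_upd => u; apply: in_dom_upd.
by apply: copy_dom; eassumption.
Qed.

(** Common to the four rules that evaluate an expression inside a statement. [wf_stmt] does not
    inspect that expression, so well-formedness can be asked for every [e']. *)
Lemma conf_ok_lift {n} (home : objid -> 'I_n) g p e l k (C : expr n -> stmt n) :
  estep home p e (g p) l k -> heap_ok home g -> expr_ok g p e ->
  (forall e', wf_stmt (C e')) ->
  (forall g' e', dom_le g g' -> expr_ok g' p e' -> stmt_ok g' p (C e')) ->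
  conf_ok home p (econf_lift C g p k).
Proof.
move=> st ok eok wf sok; have [] := estep_ok _ g _ _ _ _ _ st erefl ok eok.
case: k st => [e' h'|h'] st hok; split=> //=; split=> //.
by apply: sok => //; apply: dom_le_upd => u; apply: estep_dom st.
Qed.

(** By induction on the step, whose place index varies: the body of a dynamic [at] is judged at its
    own place. Idle substatements are carried to the new heap by [step_dom]. *)
Lemma step_ok {n} (home : objid -> 'I_n) p l k k' :
  step home p l k k' -> conf_ok home p k -> conf_ok home p k'.
Proof.
elim=> {p l k k'}.
- by move=> p g [ok _]; split.
- by move=> p v g [ok _]; split.
- move=> p x v s g l k _ IH [ok [/= [fs ws] sok]]; apply: IH.
  split=> //=; split; first exact: wf_stmt_subst.
  (* A value in the substituted body occurs in [s], or is [v], which already occurred at [p] as the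
     bound expression. *)
  move=> w q /(occurs_under_subst _ _ _ _ _ _ ws) [wq|[<- ->]]; apply: sok.
    by right.
  by left.
- move=> p o f v g ob go obf [/= ok [_ sok]]; split=> //=.
  apply: heap_ok_upd => //; first by case: (ok _ _ _ go).
  move=> f' w; rewrite /pmap_upd; case: eqP => [_ [<-]|_].
    by apply: sok; split=> //; right.
  by have [_ okf] := ok _ _ _ go; apply: okf.
- by move=> p o f v g ob _ _ [ok _]; split.
- move=> p x e s g l k st [/= ok [wf sok]].
  apply: (conf_ok_lift _ _ _ _ _ _ _ st) => //= [v ve|g' e' le e'ok v q /=].
    by apply: sok; left.
  case=> [[<-]|vs]; first exact: e'ok.
  by apply: value_ok_le le _; apply: sok; right.
- move=> p e f e1 g l k st [/= ok [wf sok]].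
  apply: (conf_ok_lift _ _ _ _ _ _ _ st) => //= [v ve|g' e' le e'ok v q /=].
    by apply: sok; split=> //; left.
  case=> <- [|ve]; first exact: e'ok.
  by apply: value_ok_le le _; apply: sok; split=> //; right.
- move=> p o f e g l k st [/= ok [wf sok]].
  apply: (conf_ok_lift _ _ _ _ _ _ _ st) => //= [v ve|g' e' le e'ok v q /=].
    by apply: sok; split=> //; right.
  case=> <- [ve|]; last exact: e'ok.
  by apply: value_ok_le le _; apply: sok; split=> //; left.
- move=> p q x e s g l k st [/= ok [wf sok]].
  apply: (conf_ok_lift _ _ _ _ _ _ _ st) => //= [v ve|g' e' le e'ok v r /=].
    by apply: sok; left.
  case=> [[<-]|vs]; first exact: e'ok.
  by apply: value_ok_le le _; apply: sok; right.
- by move=> p s g.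
- by move=> p s g l k _ IH /IH {IH}; case: k.
- by move=> p mu s g l s' g' _ IH /IH.
- by move=> p mu s g l g' _ IH /IH.
- move=> p s t g l k _ st IH [/= ok [[ws wt] sok]].
  have /stmt_ok_le/(_ (fun v q H => sok v q (or_intror H))) tok :=
    step_dom _ _ _ _ _ st.
  have: conf_ok home p k.
    by apply: IH; split=> //; split=> // v q vs; apply: sok; left.
  move=> {st IH}; case: k tok => [s' g'|g'] /= tok; last by case.
  case=> ok' [ws' sok']; split=> //; split=> // v q.
  by case; [apply: sok' | apply: tok].
- move=> p s t g v k st IH [/= ok [[ws wt] sok]]; apply: IH; split=> //.
  by split=> // w q vs; apply: sok; left.
- move=> p s t g l k _ st IH [/= ok [[wt ws] sok]].
  have /stmt_ok_le/(_ (fun v q H => sok v q (or_introl H))) tok :=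
    step_dom _ _ _ _ _ st.
  have: conf_ok home p k.
    by apply: IH; split=> //; split=> // v q vs; apply: sok; right.
  move=> {st IH}; case: k tok => [s' g'|g'] /= tok; last by case.
  case=> ok' [ws' sok']; split=> //; split=> // v q.
  by case; [apply: tok | apply: sok'].
- move=> p q x v s g v' g' cp [/= ok [[fs ws] sok]].
  have [|ok' vok] := copy_ok _ p _ _ _ _ _ cp ok; first by apply: sok; left.
  split=> //=; split.
    split; last by split=> //; apply: wf_stmt_subst.
    (* The new dynamic [at] is closed: [x] was the only possible free variable of [s] and has been
       substituted. *)
    move=> y; rewrite orbF stmt_free_subst; apply/negP => /andP[yx /fs] /eqP.
    exact/negP.
  move=> w r /= [] //.
  (* Values of [s] survive because copying enlarges domains; the only newcomer at [q] is [v'],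
     covered by [vok]. *)
  case/(occurs_under_subst _ _ _ _ _ _ ws) => [ws'|[<- ->]] //.
  by apply: value_ok_le (copy_dom _ _ _ _ _ _ cp) _; apply: sok; right.
- move=> p q s g l k st IH [/= ok [[fs ws] sok]].
  have: conf_ok home q k by apply: IH.
  case: k st {IH} => [s' g'|g'] //= st [ok' [ws' sok']]; split=> //; split=> //.
  split=> // y; apply/negP => /(step_free _ _ _ _ _ y st) /=.
  exact/negP.
- move=> p s t g l k _ st IH [/= ok [[ws wt] sok]].
  have /stmt_ok_le/(_ (fun v q H => sok v q (or_intror H))) tok :=
    step_dom _ _ _ _ _ st.
  have: conf_ok home p k.
    by apply: IH; split=> //; split=> // v q vs; apply: sok; left.
  move=> {st IH}; case: k tok => [s' g'|g'] //= tok.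
  case=> ok' [ws' sok']; split=> //; split=> // v q.
  by case; [apply: sok' | apply: tok].
- move=> p s t g v k st IH [/= ok [[ws wt] sok]].
  have /stmt_ok_le/(_ (fun v q H => sok v q (or_intror H))) tok :=
    step_dom _ _ _ _ _ st.
  have: conf_ok home p k.
    by apply: IH; split=> //; split=> // w q vs; apply: sok; left.
  move=> {st IH}; case: k tok => [s' g'|g'] /= tok; last by case.
  case=> ok' [ws' sok']; split=> //; split=> // w q.
  by case; [apply: sok' | apply: tok].
Qed.

(** [wf_stmt] and [grefs_defined] reappear among the conclusions for a running configuration, so the
    result iterates along an execution. *)
Theorem proposition2p9 (n : nat) (home : objid -> 'I_n)
    (p : 'I_n) (l : label) (s : stmt n) (g : gheap n) :
  wf_stmt s -> grefs_defined g -> place_local_config home p s g ->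
  (forall (s' : stmt n) (g' : gheap n),
      step home p l (Run s g) (Run s' g') ->
      [/\ wf_stmt s', grefs_defined g' & place_local_config home p s' g']) /\
  (forall g' : gheap n,
      step home p l (Run s g) (Done g') ->
      grefs_defined g' /\ place_local_heap home g').
Proof.
move=> ws gd pl.
have [ok sok] := (place_local_configP home p s g).1 (conj gd pl).
have kok : conf_ok home p (Run s g) by [].
split=> [s' g' st|g' st].
  have [ok' [ws' sok']] := step_ok _ _ _ _ _ st kok.
  by have [] := (place_local_configP home p s' g').2 (conj ok' sok').
by have [ok' _] := step_ok _ _ _ _ _ st kok; apply/heap_okP.
Qed.
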